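(* There is an absolute constant $C$ such that for any metric space $M=(V,d)$ on $|V|=n$ points, any $\beta>1$, any $k>1$ and any $1<\ell\le k$, there exists a subset $S\subseteq V$ such that $|S|\ge n^{\frac{1}{\beta\lceil\log_\ell k\rceil}}$ and $(S,d)$ $O(\ell\log_\beta\log n)$-approximates some $k$-HST (the $O(\cdot)$ hiding the absolute constant $C$).
   Context: A metric space $(X,d)$ $\alpha$-approximates a metric space $(X,d')$ on the same set if $d'(u,v)\le d(u,v)\le\alpha d'(u,v)$ for all $u,v\in X$. For $k\ge1$, a $k$-HST is a metric space defined on the leaves of a rooted tree $T$, where each vertex $u$ carries a label $\Delta(u)\ge0$ with $\Delta(u)=0$ iff $u$ is a leaf, and if $u$ is a child of $v$ then $\Delta(u)\le\Delta(v)/k$; the distance between leaves $x,y$ is $\Delta(\mathrm{lca}(x,y))$.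
   Formalization: The factor O(ℓ log_β log n) is taken as max(1, C·ℓ·log_β ln n), since without the maximum the claim fails (e.g. n = 2, or β very large, where the factor is below 1 yet S must contain two points); V is assumed nonempty. *)

(* Defs.v *)
From HB Require Import structures.
From mathcomp Require Import all_boot all_order all_algebra.
From mathcomp Require Import reals exp.

Set Implicit Arguments.
Unset Strict Implicit.
Unset Printing Implicit Defensive.

Import Order.TTheory GRing.Theory Num.Theory.

Local Open Scope ring_scope.

(* Metrics are plain functions, not a [metricType] structure on the carrier,
   because two distances on one and the same set have to be compared. *)
Definition is_metric (R : realType) (X : Type) (d : X -> X -> R) : Prop :=
  [/\ forall x y, 0 <= d x y,
      forall x y, d x y = 0 <-> x = y,
      forall x y, d x y = d y x &
      forall x y z, d x z <= d x y + d y z].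

Definition submetric (R : realType) (V : finType) (d : V -> V -> R)
    (S : {set V}) : {x : V | x \in S} -> {x : V | x \in S} -> R :=
  fun u v => d (val u) (val v).
Arguments submetric {R V} d S u v.

Definition approximates (R : realType) (X : Type) (alpha : R)
    (d d' : X -> X -> R) : Prop :=
  forall u v, d' u v <= d u v /\ d u v <= alpha * d' u v.

(* The parent map fixes the root and every vertex reaches the root by iterating
   it, so the map has no other cycle. *)
Record rooted_tree : Type := RootedTree {
  node :> finType;
  tree_root : node;
  tree_parent : node -> node;
  tree_parent_root : tree_parent tree_root = tree_root;
  connect_tree_root : forall u, fconnect tree_parent u tree_root }.

Section RootedTree.

Variable T : rooted_tree.
Implicit Types a b u v x y : T.

Definition child u v : bool := (u != tree_root T) && (tree_parent u == v).

Definition leaf v : bool := [forall u, ~~ child u v].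

(* Reflexive: every vertex is its own ancestor. *)
Definition ancestor a u : bool := fconnect (@tree_parent T) u a.

Definition is_lca a x y : Prop :=
  [/\ ancestor a x, ancestor a y &
      forall b, ancestor b x -> ancestor b y -> ancestor b a].

End RootedTree.

Definition HST_label (R : realType) (k : R) (T : rooted_tree)
    (Delta : T -> R) : Prop :=
  [/\ forall u, 0 <= Delta u,
      forall u, Delta u = 0 <-> leaf u &
      forall u v, child u v -> Delta u <= Delta v / k].

(* The points are identified with the leaves of the tree through the
   injection [f]. *)
Definition is_HST (R : realType) (k : R) (X : finType) (d : X -> X -> R)
    : Prop :=
  is_metric d /\
  exists (T : rooted_tree) (Delta : T -> R) (f : X -> T),
    [/\ HST_label k Delta,
        injective f,
        forall u, leaf u <-> exists x, f x = u &
        forall x y, exists2 a, is_lca a (f x) (f y) & d x y = Delta a].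

Definition logb (R : realType) (b x : R) : R := ln x / ln b.

(* Main.v *)
(* A set of diameter D is cut into two parts: around one end of a diameter the
   closed ball of radius D/3 contains at most half of the points, and for some
   i < t the shell between the radii iD/(3t) and (i+1)D/(3t) can be discarded so
   that the parts A1, A2 left on its two sides satisfy
   |A|^(1/beta) <= |A1|^(1/beta) + |A2|^(1/beta).  Here t is about
   log_beta log_2 n.  Points separated at this stage are at distance between
   D/(3t) and D.  Iterating, and rounding D/(3t) down by a factor of at most l,
   gives an ultrametric.  To have ratios at least k between consecutive labels,
   the levels are coloured cyclically with m = ceil(log_l k) colours, and for
   each colour a subset is built that only branches at levels of that colour and
   follows the larger side elsewhere; the product of the m sizes is at least
   n^(1/beta), so one of the subsets has the required size.
   When n <= 2^beta two points are enough. *)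
Require Import Defs.
From HB Require Import structures.
From mathcomp Require Import all_boot all_order all_algebra.
From mathcomp Require Import reals sequences exp.
From mathcomp Require Import ring lra.

Set Implicit Arguments.
Unset Strict Implicit.
Unset Printing Implicit Defensive.

Import Order.TTheory GRing.Theory Num.Theory.

Local Open Scope ring_scope.

Definition is_ultrametric (R : realType) (X : Type) (u : X -> X -> R) : Prop :=
  forall x y z, u x z <= Num.max (u x y) (u y z).

(** * From ultrametrics to trees *)

Section LaminarTree.

Variables (X : finType) (F : {set {set X}}).
Hypotheses (F_setT : setT \in F) (F_set0 : set0 \notin F).
Hypothesis F_laminar : forall A B, A \in F -> B \in F ->
  forall x, x \in A -> x \in B -> A \subset B \/ B \subset A.

Let T := {A : {set X} | A \in F}.

Definition laminar_root : T := Sub setT F_setT.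

(** Minimal cardinality picks a least member: by laminarity the members of [F] containing a given
    nonempty one form a chain. *)
Definition laminar_parent (A : T) : T :=
  if A == laminar_root then laminar_root
  else [arg min_(B < laminar_root | val A \proper val B) #|val B|]%N.

Lemma laminar_parent_root : laminar_parent laminar_root = laminar_root.
Proof. by rewrite /laminar_parent eqxx. Qed.

Lemma laminar_parentP (A : T) : A != laminar_root ->
  val A \proper val (laminar_parent A) /\
  forall B : T, val A \proper val B -> val (laminar_parent A) \subset val B.
Proof.
move=> AT; rewrite /laminar_parent (negPf AT).
case: arg_minnP => [|B AB minB].
  rewrite properEneq subsetT andbT.
  by apply: contra AT => /eqP AT; apply/eqP/val_inj.
split=> // C AC.
have [x xA] : exists x, x \in val A.
  by apply/set0Pn; apply: contraNneq F_set0 => <-; apply: valP.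
have xB := subsetP (proper_sub AB) x xA.
have xC := subsetP (proper_sub AC) x xA.
have [//|CB] := F_laminar (valP B) (valP C) xB xC.
have /eqP -> // : val C == val B by rewrite eqEcard CB minB.
Qed.

(** Climbing cannot jump over [B]: each parent lies inside every member properly containing its
    child. *)
Lemma fconnect_laminar_parent (A B : T) :
  fconnect laminar_parent A B = (val A \subset val B).
Proof.
apply/idP/idP.
  move/iter_findex; move: (findex _ _ _) => n.
  elim: n A => [|n IHn] A; first by move=> /= ->.
  rewrite iterSr => /IHn; apply: subset_trans.
  have [->|/laminar_parentP[/proper_sub//]] := eqVneq A laminar_root.
  by rewrite laminar_parent_root.
have [n] := ubnP (#|X| - #|val A|)%N; elim: n A => // n IHn A lt_n AB.
have [->|AneB] := eqVneq A B; first exact: connect0.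
have ltAB : val A \proper val B.
  by rewrite properEneq AB andbT; apply: contra AneB => /eqP/val_inj ->.
have AneT : A != laminar_root.
  apply: contraTneq ltAB => ->; rewrite properE negb_and negbK.
  by rewrite subsetT orbT.
have [ltAp minp] := laminar_parentP AneT.
apply: connect_trans (fconnect1 _ _) (IHn _ _ (minp _ ltAB)).
have := proper_card ltAp; have := max_card (mem (val (laminar_parent A))).
move=> le_X lt_A; rewrite -ltnS; apply: leq_trans lt_n.
by rewrite ltnS ltn_sub2l // (leq_trans lt_A).
Qed.

Lemma fconnect_laminar_root A : fconnect laminar_parent A laminar_root.
Proof. by rewrite fconnect_laminar_parent subsetT. Qed.

Definition laminar_tree : rooted_tree :=
  RootedTree laminar_parent_root fconnect_laminar_root.

Lemma laminar_child_proper (A B : laminar_tree) :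
  child A B -> val A \proper val B.
Proof. by case/andP=> /laminar_parentP[ltA _] /eqP <-. Qed.

(** On the path of parents from [A] up to [B], the last vertex before [B] is a child of [B]. *)
Lemma laminar_leafPn (A B : laminar_tree) : val A \proper val B -> ~~ leaf B.
Proof.
move=> ltAB.
have : fconnect laminar_parent A B.
  by rewrite fconnect_laminar_parent proper_sub.
move/iter_findex; move: (findex _ _ _) => n.
elim: n A ltAB => [|n IHn] A ltAB /=.
  by move=> eAB; move: ltAB; rewrite eAB properxx.
rewrite -iterS iterSr.
have AneT : A != laminar_root.
  apply: contraTneq ltAB => ->; rewrite properE negb_and negbK.
  by rewrite subsetT orbT.
have [_ minp] := laminar_parentP AneT.
have [pB _|pB] := eqVneq (laminar_parent A) B.
  apply/forallPn; exists A; rewrite negbK /child.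
  by apply/andP; split=> //; apply/eqP.
apply: IHn; rewrite properEneq minp // andbT.
by apply: contra pB => /eqP/val_inj ->.
Qed.

End LaminarTree.

(** * The tree of balls of an ultrametric *)

Section UltrametricTree.

Variables (R : realType) (k : R) (X : finType) (u : X -> X -> R).
Hypotheses (u_metric : is_metric u) (u_ultra : is_ultrametric u).

(** Radii are realised distances, so pairs of points index the balls; by the ultrametric inequality
    the radius is also the diameter. *)
Definition uball x y : {set X} := [set z | u x z <= u x y].

Lemma uball_le p q x y : x \in uball p q -> y \in uball p q -> u x y <= u p q.
Proof.
have [_ _ u_sym _] := u_metric; rewrite !inE => xB yB.
by apply: le_trans (u_ultra x p y) _; rewrite ge_max u_sym xB.
Qed.

Lemma uball_sub p q x y : x \in uball p q -> y \in uball p q ->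
  uball x y \subset uball p q.
Proof.
move=> xB yB; apply/subsetP=> z; rewrite [z \in uball x y]inE => zB.
have := xB; rewrite !inE => xB'.
apply: le_trans (u_ultra p x z) _; rewrite ge_max xB' /=.
exact: le_trans zB (uball_le xB yB).
Qed.

Lemma uball_left p q : p \in uball p q.
Proof.
by have [u_ge0 u_eq0 _ _] := u_metric; rewrite inE (u_eq0 p p).2.
Qed.

Lemma uball_right p q : q \in uball p q.
Proof. by rewrite inE. Qed.


(** Every point of an ultrametric ball is a centre of it, so both balls may be centred at [z]. *)
Lemma uball_laminar p q x y z : z \in uball p q -> z \in uball x y ->
  u p q <= u x y -> uball p q \subset uball x y.
Proof.
have [_ _ u_sym _] := u_metric; rewrite inE => zpq zxy le_u.
apply/subsetP=> w; rewrite inE => wpq.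
have zw : u z w <= u x y.
  by apply: le_trans (u_ultra z p w) (le_trans _ le_u); rewrite ge_max u_sym zpq.
move: zxy; rewrite !inE => zxy.
by apply: le_trans (u_ultra x z w) _; rewrite ge_max zxy.
Qed.

Definition uballs : {set {set X}} := [set uball p.1 p.2 | p : X * X].

Lemma mem_uballs x y : uball x y \in uballs.
Proof. by apply/imsetP; exists (x, y). Qed.

Lemma uballs_setT (x0 : X) : setT \in uballs.
Proof.
have [y _ maxy] := @arg_maxP _ _ _ x0 xpredT (u x0) isT.
have -> : setT = uball x0 y by apply/setP=> z; rewrite !inE [RHS]maxy.
exact: mem_uballs.
Qed.

Lemma uballs_set0 : set0 \notin uballs.
Proof.
by apply/imsetP=> -[[x y] _] /setP/(_ x); rewrite uball_left inE.
Qed.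

Lemma uballs_laminar A B : A \in uballs -> B \in uballs ->
  forall x, x \in A -> x \in B -> A \subset B \/ B \subset A.
Proof.
case/imsetP=> -[p q] _ -> /imsetP[[x y] _ ->] z /= zA zB.
have [le_u|/ltW le_u] := leP (u p q) (u x y).
  by left; apply: uball_laminar le_u; eassumption.
by right; apply: uball_laminar le_u; eassumption.
Qed.

(* A ball of positive radius is recovered from its diameter, so a ball properly
   contained in another one has a strictly smaller diameter, and the gap
   hypothesis yields the factor [k]. *)
Lemma ultrametric_is_HST (x0 : X) : 1 < k ->
  (forall x y z w, u x y < u z w -> u x y <= u z w / k) -> is_HST k u.
Proof.
move=> k_gt1 u_gap; have [u_ge0 u_eq0 u_sym _] := u_metric; split=> //.
have k_gt0 : 0 < k by apply: lt_trans k_gt1.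
pose T := laminar_tree (uballs_setT x0) uballs_set0 uballs_laminar.
(* One presentation is chosen per ball; the label is the diameter whichever is chosen. *)
have [Delta DeltaP] : exists Delta : T -> R, forall B,
    exists p q, val B = uball p q /\ Delta B = u p q.
  apply: (@fin_all_exists T (fun=> R)
    (fun B r => exists p q, val B = uball p q /\ r = u p q)) => B.
  have /imsetP[[p q] _ defB] := valP B.
  by exists (u p q), p, q.
pose node_of x y : T := Sub (uball x y) (mem_uballs x y).
have uballxx x : uball x x = [set x].
  apply/setP=> z; rewrite !inE (u_eq0 x x).2 //.
  apply/idP/eqP=> [xz|->]; last by rewrite (u_eq0 x x).2.
  by apply/esym/u_eq0/le_anti; rewrite xz u_ge0.
have Delta_ge (B : T) x y : x \in val B -> y \in val B -> u x y <= Delta B.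
  by have [p [q [-> ->]]] := DeltaP B; apply: uball_le.
have Delta_lt (A B : T) : val A \proper val B -> Delta A < Delta B.
  move=> /properP[/subsetP AB [z zB zNA]].
  have [p [q [defA DA]]] := DeltaP A.
  have pA : p \in val A by rewrite defA uball_left.
  apply: contraNlt zNA => le_BA; rewrite defA inE -DA.
  by apply: le_trans le_BA; apply: Delta_ge => //; apply: AB.
have Delta_ge0 (B : T) : 0 <= Delta B by have [p [q [_ ->]]] := DeltaP B.
have Delta_leaf (B : T) : Delta B = 0 <-> leaf B.
  split=> [B0|].
    apply/forallP=> A; apply/negP=> /laminar_child_proper/Delta_lt.
    by rewrite B0 ltNge Delta_ge0.
  have [p [q [defB ->]]] := DeltaP B => B_leaf; apply/u_eq0/eqP.
  apply: contraTT B_leaf => pneq.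
  apply: (@laminar_leafPn _ _ (uballs_setT x0) uballs_set0 uballs_laminar
    (node_of p p)); apply/properP; split.
    by rewrite /= defB uball_sub ?uball_left.
  by exists q; rewrite ?defB ?uball_right //= uballxx inE eq_sym.
exists T, Delta, (fun x => node_of x x); split.
- split=> // A B /laminar_child_proper/Delta_lt.
  have [p [q [_ ->]]] := DeltaP A; have [x [y [_ ->]]] := DeltaP B.
  exact: u_gap.
- by move=> x y /(congr1 val) /=; rewrite !uballxx => /set1_inj.
- move=> B; rewrite -Delta_leaf; have [p [q [defB ->]]] := DeltaP B.
  split=> [/u_eq0 epq | [x defx]].
    by exists p; apply: val_inj; rewrite defB /= epq.
  have : uball x x = uball p q by rewrite -defB -defx.
  rewrite uballxx => /setP exB; apply/u_eq0.
  have := exB p; rewrite uball_left => /set1P ->.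
  by have := exB q; rewrite uball_right => /set1P ->.
(* The smallest ball containing both points is their lowest common ancestor. *)
move=> x y; exists (node_of x y).
  have ancE (A B : T) : ancestor A B = (val B \subset val A).
    exact: (fconnect_laminar_parent (uballs_setT x0) uballs_set0 uballs_laminar).
  split=> [||B]; rewrite !ancE /=.
  + by rewrite uball_sub ?uball_left.
  + by rewrite uball_sub ?uball_right.
  have [p [q [-> _]]] := DeltaP B => /subsetP/(_ x (uball_left x x)) xB.
  by move=> /subsetP/(_ y (uball_left y y)) yB; apply: uball_sub.
have [p [q [defB DB]]] := DeltaP (node_of x y).
apply/le_anti/andP; split; first by rewrite Delta_ge //= ?uball_left ?uball_right.
by rewrite DB; apply: uball_le; rewrite -[uball x y]/(val (node_of x y)) defB
  ?uball_left ?uball_right.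
Qed.

End UltrametricTree.

(** * Separating a metric space *)

(** With x = a/N and y = b/N the last hypothesis reads x^(1/beta) + (1-y)^(1/beta) < 1; since 1-y <=
    (1-y)^(1/beta), it gives x^(1/beta) < y. *)
Lemma powR_split_bound (R : realType) (beta N a b : R) :
  1 < beta -> 0 < N -> 0 <= a -> 0 <= b -> b <= N ->
  powR a beta^-1 + powR (N - b) beta^-1 < powR N beta^-1 ->
  a / N <= powR (b / N) beta.
Proof.
move=> beta_gt1 N_gt0 a_ge0 b_ge0 le_bN.
have beta_gt0 : 0 < beta by apply: lt_trans beta_gt1.
have scale c : 0 <= c -> powR c beta^-1 = powR (c / N) beta^-1 * powR N beta^-1.
  move=> c_ge0; rewrite -powRM ?divr_ge0 // ?(ltW N_gt0) //.
  by rewrite divfK // gt_eqF.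
rewrite (scale a) // (scale (N - b)) ?subr_ge0 // -mulrDl.
rewrite gtr_pMl ?powR_gt0 // mulrBl divff ?gt_eqF // => lt1.
have le_pow : 1 - b / N <= powR (1 - b / N) beta^-1.
  have [->|neq0] := eqVneq (1 - b / N) 0; first exact: powR_ge0.
  apply: ger1_powR; last by rewrite invf_le1 // ltW.
  rewrite lt_neqAle eq_sym neq0 subr_ge0 ler_pdivrMr // mul1r le_bN /=.
  by rewrite gerBl divr_ge0 // ltW.
have le_s : powR (a / N) beta^-1 <= b / N by lra.
have aN_ge0 : 0 <= a / N by rewrite divr_ge0 // ltW.
have -> : a / N = powR (powR (a / N) beta^-1) beta.
  by rewrite -powRrM mulVf ?gt_eqF // powRr1.
by apply: ge0_ler_powR; rewrite ?nnegrE ?powR_ge0 ?divr_ge0 // ltW.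
Qed.

(* If no shell between consecutive balls can be removed at the required price,
   the relative sizes x_i of the balls satisfy x_i <= x_(i+1)^beta, so the
   largest one, of relative size at most 1/2, forces x_0 < 1 / #|A|. *)
Lemma metric_split (R : realType) (V : finType) (d : V -> V -> R) (beta : R)
    (t : nat) (A : {set V}) :
  is_metric d -> 1 < beta -> (0 < t)%N -> (1 < #|A|)%N ->
  ln #|A|%:R < beta ^+ t * ln 2 ->
  exists (A1 A2 : {set V}) (x y : V),
    [/\ A1 \proper A, A2 \proper A,
        [/\ x \in A, y \in A, 0 < d x y &
            forall a b, a \in A -> b \in A -> d a b <= d x y],
        forall a b, a \in A1 -> b \in A2 -> d x y / (3 * t%:R) < d a b &
        powR #|A|%:R beta^-1 <= powR #|A1|%:R beta^-1 + powR #|A2|%:R beta^-1].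
Proof.
move=> [d_ge0 d_eq0 d_sym d_tri] beta_gt1 t_gt0 A_gt1 lt_ln.
have beta_gt0 : 0 < beta by apply: lt_trans beta_gt1.
have [x0 [y0 [x0A y0A xy0]]] := card_gt1P A_gt1.
have [|[x y] /= /andP[xA yA] maxd] := @arg_maxP _ _ _ (x0, x0)
  [pred p | (p.1 \in A) && (p.2 \in A)] (fun p => d p.1 p.2).
  by rewrite /= x0A.
have {}maxd a b : a \in A -> b \in A -> d a b <= d x y.
  by move=> aA bA; apply: (maxd (a, b)); rewrite /= aA.
set D := d x y in maxd *.
have D_gt0 : 0 < D.
  apply: lt_le_trans (maxd x0 y0 x0A y0A).
  rewrite lt_neqAle d_ge0 andbT eq_sym.
  by apply: contra xy0 => /eqP/d_eq0 ->.
have tR : 0 < t%:R :> R by rewrite ltr0n.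
pose r := D / (3 * t%:R).
have r_gt0 : 0 < r by rewrite divr_gt0 // mulr_gt0.
pose B z i := [set w in A | d z w <= i%:R * r].
have tr : t%:R * r = D / 3 by rewrite /r; field; rewrite gt_eqF.
(* The balls of radius D/3 around the two ends of the diameter are disjoint, so one of them holds at
   most half of [A]. *)
have [z zA le_half] : exists2 z, z \in A & (#|B z t|.*2 <= #|A|)%N.
  have disj : [disjoint B x t & B y t].
    rewrite -setI_eq0; apply/set0Pn=> -[w]; rewrite !inE.
    case/andP=> /andP[_ xw] /andP[_ yw].
    have := d_tri x w y; rewrite (d_sym w) -/D; move: xw yw; rewrite tr.
    by move: (d x w) (d y w) => p q; lra.
  have : (#|B x t| + #|B y t| <= #|A|)%N.
    have /eqP <- : #|B x t :|: B y t| == (#|B x t| + #|B y t|)%N.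
      by rewrite (leq_card_setU (B x t) (B y t)).2.
    by apply: subset_leq_card; apply/subsetP=> w; rewrite !inE => /orP[] /andP[].
  move=> le_sum; have [le_xy|/ltnW le_yx] := leqP #|B x t| #|B y t|.
    by exists x => //; rewrite -addnn; apply: leq_trans le_sum; rewrite leq_add2l.
  by exists y => //; rewrite -addnn; apply: leq_trans le_sum; rewrite leq_add2r.
have BA i : B z i \subset A by apply/subsetP=> w; rewrite inE => /andP[].
have B_mono i j : (i <= j)%N -> B z i \subset B z j.
  move=> ij; apply/subsetP=> w; rewrite !inE => /andP[-> /le_trans] /=; apply.
  by rewrite ler_pM2r // ler_nat.
have zB i : z \in B z i.
  by rewrite inE zA (d_eq0 z z).2 // mulr_ge0 // ltW.
have A_gt0 : (0 < #|A|)%N by apply: ltnW.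
have [/existsP[i good]|bad] := boolP [exists i : 'I_t,
    powR #|A|%:R beta^-1 <=
    powR #|B z i|%:R beta^-1 + powR (#|A|%:R - #|B z i.+1|%:R) beta^-1 :> R].
  exists (B z i), (A :\: B z i.+1), x, y; split=> //.
  - rewrite properEcard BA /=.
    apply: leq_ltn_trans (subset_leq_card (B_mono _ _ (ltnW (ltn_ord i)))) _.
    rewrite -(ltn_pmul2r (isT : (0 < 2)%N)) !muln2.
    by apply: leq_ltn_trans le_half _; rewrite -addnn -ltn_psubLR // subnn.
  - rewrite properE subsetDl /=; apply/subsetPn; exists z => //.
    by rewrite inE zB.
  - move=> a b; rewrite !inE => /andP[aA za] /andP[+ bA].
    rewrite bA /= -ltNge -natr1 mulrDl mul1r => zb.
    have := d_tri z a b; move: za zb; rewrite -/r.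
    by move: (d z a) (d z b) (d a b) (i%:R * r) => *; lra.
  - by rewrite cardsDS // natrB // subset_leq_card.
have {}bad i : (i < t)%N ->
    #|B z i|%:R / #|A|%:R <= powR (#|B z i.+1|%:R / #|A|%:R) beta :> R.
  move=> lt_it; move: bad; rewrite negb_exists => /forallP/(_ (Ordinal lt_it)).
  rewrite -ltNge /=; apply: powR_split_bound; rewrite ?ltr0n ?ler_nat //.
  exact: subset_leq_card.
have chain j : (j <= t)%N ->
    #|B z 0|%:R / #|A|%:R <= powR (#|B z j|%:R / #|A|%:R) (beta ^+ j) :> R.
  elim: j => [|j IHj] lt_jt; first by rewrite expr0 powRr1 // divr_ge0.
  apply: le_trans (IHj (ltnW lt_jt)) _; rewrite exprS powRrM.
  apply: ge0_ler_powR (bad _ lt_jt); rewrite ?nnegrE ?powR_ge0 ?divr_ge0 //.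
  by rewrite exprn_ge0 // ltW.
have AR : 0 < #|A|%:R :> R by rewrite ltr0n.
have half : #|B z t|%:R / #|A|%:R <= 2^-1 :> R.
  rewrite ler_pdivrMr // mulrC ler_pdivlMr // -natrM ler_nat.
  by rewrite muln2.
(* The innermost ball contains [z], so its relative size is at least 1/#|A|. *)
have: (#|A|%:R)^-1 <= powR 2^-1 (beta ^+ t) :> R.
  apply: le_trans (le_trans (chain t (leqnn t)) _).
    rewrite -[leLHS]mul1r ler_pM2r ?invr_gt0 // ler1n card_gt0.
    by apply/set0Pn; exists z.
  by apply: ge0_ler_powR; rewrite ?nnegrE ?divr_ge0 ?exprn_ge0 ?invr_ge0 // ltW.
rewrite -ler_ln ?posrE ?invr_gt0 ?powR_gt0 ?invr_gt0 // ln_powR !lnV ?posrE //.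
by rewrite mulrN lerN2 leNgt lt_ln.
Qed.

(** * Hierarchical subsets, one per colour *)

Section Hierarchy.

Variables (R : realType) (V : finType) (d : V -> V -> R).
Hypothesis d_metric : is_metric d.

(* [g D] is the value given to a pair separated at diameter [D], and [c D] is
   the colour of the corresponding level. *)
Variables (p : nat) (g : R -> R) (c : R -> 'I_p.+1) (alpha : R).
Hypotheses (g_gt0 : forall D, 0 < D -> 0 < g D)
  (g_le : forall D E, 0 < D -> D <= E -> g D <= g E)
  (g_approx : forall D, 0 < D -> D <= alpha * g D).

(** [u] is total on [V] but constrained only on [S], which keeps gluing free of subtypes. Its
    nonzero values come from distances inside [A], so monotonicity of [g] bounds them by the value
    at the diameter of any larger set. *)
Definition monochromatic (A : {set V}) (r : 'I_p.+1) (S : {set V}) : Prop :=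
  S \subset A /\ exists u : V -> V -> R,
  [/\ {in S, forall x, u x x = 0},
      {in S &, forall x y, u x y = u y x},
      {in S &, forall x y, x != y -> exists a b,
        [/\ a \in A, b \in A, 0 < d a b, c (d a b) = r & u x y = g (d a b)]},
      {in S & &, forall x y z, u x z <= Num.max (u x y) (u y z)} &
      {in S &, forall x y, u x y <= d x y /\ d x y <= alpha * u x y}].

Lemma monochromatic_sub (A B : {set V}) r S :
  A \subset B -> monochromatic A r S -> monochromatic B r S.
Proof.
move=> /subsetP AB [/subsetP SA [u [u0 u_sym u_val u_ultra u_d]]].
split; first by apply/subsetP=> x /SA/AB.
exists u; split=> // x y xS yS /(u_val x y xS yS)[a [b [aA bA ab cr ->]]].
by exists a, b; split=> //; apply: AB.
Qed.

Lemma monochromatic_small (A : {set V}) r : (#|A| <= 1)%N -> monochromatic A r A.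
Proof.
have [_ d_eq0 _ _] := d_metric.
move=> /card_le1_eqP A1; split=> //; exists (fun _ _ => 0).
split=> // [x y xA yA|x y z _ _ _|x y xA yA].
- by rewrite (A1 x y xA yA) eqxx.
- by rewrite maxxx.
have -> : d x y = 0 by apply/d_eq0/A1.
by rewrite mulr0.
Qed.

(** Cross pairs get [g (d x y)], which dominates all values inside either side because [d x y] is
    the diameter of [A]; this gives the ultrametric inequality. *)
Lemma monochromatic_setU (A A1 A2 S1 S2 : {set V}) x y :
  A1 \subset A -> A2 \subset A -> x \in A -> y \in A -> 0 < d x y ->
  (forall a b, a \in A -> b \in A -> d a b <= d x y) ->
  (forall a b, a \in A1 -> b \in A2 -> g (d x y) <= d a b) ->
  monochromatic A1 (c (d x y)) S1 -> monochromatic A2 (c (d x y)) S2 ->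
  monochromatic A (c (d x y)) (S1 :|: S2).
Proof.
have [d_ge0 d_eq0 d_sym _] := d_metric.
move=> A1A A2A xA yA xy_gt0 maxd sep.
move=> /[dup] /(monochromatic_sub A1A) [S1A _] [S1A1 [u1 [u10 u1s u1v u1u u1d]]].
move=> /[dup] /(monochromatic_sub A2A) [S2A _] [S2A2 [u2 [u20 u2s u2v u2u u2d]]].
have D_gt0 := g_gt0 xy_gt0.
(* A point common to [A1] and [A2] would be at positive distance from itself. *)
have A1in a : a \in S1 -> (a \in A1) * (a \in A2 = false) * (a \in A).
  move=> aS; have aA1 := subsetP S1A1 a aS; rewrite aA1 (subsetP S1A a aS).
  split=> //; split=> //; apply/negP=> aA2; have := sep a a aA1 aA2.
  by rewrite (d_eq0 a a).2 // leNgt D_gt0.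
have A2in a : a \in S2 -> (a \in A1 = false) * (a \in A2) * (a \in A).
  move=> aS; have aA2 := subsetP S2A2 a aS; rewrite aA2 (subsetP S2A a aS).
  split=> //; split=> //; apply/negP=> aA1; have := sep a a aA1 aA2.
  by rewrite (d_eq0 a a).2 // leNgt D_gt0.
have u1_le a b : a \in S1 -> b \in S1 -> u1 a b <= g (d x y).
  move=> aS bS; have [<-|/(u1v a b aS bS)] := eqVneq a b.
    by rewrite u10 // ltW.
  case=> [a' [b' [a'A b'A ab_gt0 _ ->]]]; apply: g_le => //.
  by apply: maxd; apply: (subsetP A1A).
have u2_le a b : a \in S2 -> b \in S2 -> u2 a b <= g (d x y).
  move=> aS bS; have [<-|/(u2v a b aS bS)] := eqVneq a b.
    by rewrite u20 // ltW.
  case=> [a' [b' [a'A b'A ab_gt0 _ ->]]]; apply: g_le => //.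
  by apply: maxd; apply: (subsetP A2A).
have d_le a b : a \in A -> b \in A -> d a b <= alpha * g (d x y).
  by move=> aA bA; apply: le_trans (maxd a b aA bA) (g_approx xy_gt0).
split; first by rewrite subUset S1A.
exists (fun a b => if (a \in A1) && (b \in A1) then u1 a b
  else if (a \in A2) && (b \in A2) then u2 a b else g (d x y)).
split.
- by move=> a /setUP[] aS; rewrite ?(A1in a aS) ?(A2in a aS) /= ?u10 ?u20.
- move=> a b /setUP[] aS /setUP[] bS;
    rewrite ?(A1in a aS) ?(A2in a aS) ?(A1in b bS) ?(A2in b bS) //=.
    exact: u1s.
  exact: u2s.
- move=> a b /setUP[] aS /setUP[] bS neq_ab;
    rewrite ?(A1in a aS) ?(A2in a aS) ?(A1in b bS) ?(A2in b bS) /=.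
  + have [a' [b' [a'A b'A ab_gt0 cr ->]]] := u1v a b aS bS neq_ab.
    by exists a', b'; split; rewrite ?(subsetP A1A).
  + by exists x, y.
  + by exists x, y.
  + have [a' [b' [a'A b'A ab_gt0 cr ->]]] := u2v a b aS bS neq_ab.
    by exists a', b'; split; rewrite ?(subsetP A2A).
- move=> a b e /setUP[] aS /setUP[] bS /setUP[] eS;
  rewrite ?(A1in a aS) ?(A2in a aS) ?(A1in b bS) ?(A2in b bS)
    ?(A1in e eS) ?(A2in e eS) /= ?le_max ?lexx ?orbT //;
  by [rewrite -le_max; apply: u1u | rewrite -le_max; apply: u2u
     |rewrite u1_le | rewrite u2_le].
- move=> a b /setUP[] aS /setUP[] bS;
    rewrite ?(A1in a aS) ?(A2in a aS) ?(A1in b bS) ?(A2in b bS) /=.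
  + exact: u1d.
  + by rewrite sep ?(A1in a aS) ?(A2in b bS) // d_le ?(A1in a aS) ?(A2in b bS).
  + by rewrite (d_sym a) sep ?(A1in b bS) ?(A2in a aS) // d_le
      ?(A1in b bS) ?(A2in a aS).
  + exact: u2d.
Qed.

(* One family per colour is built simultaneously: at a separation of colour [r]
   the family [r] keeps both sides while every other family keeps its larger
   side, so the product of the sizes is superadditive. *)
Lemma monochromatic_exists (s : R) (A : {set V}) : 0 < s ->
  (forall B : {set V}, B \subset A -> (1 < #|B|)%N ->
    exists (A1 A2 : {set V}) (x y : V),
    [/\ A1 \proper B, A2 \proper B,
        [/\ x \in B, y \in B, 0 < d x y &
            forall a b, a \in B -> b \in B -> d a b <= d x y],
        forall a b, a \in A1 -> b \in A2 -> g (d x y) <= d a b &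
        powR #|B|%:R s <= powR #|A1|%:R s + powR #|A2|%:R s]) ->
  exists S : 'I_p.+1 -> {set V},
    (forall r, monochromatic A r (S r)) /\
    powR #|A|%:R s <= (\prod_r #|S r|)%N%:R.
Proof.
move=> s_gt0; have [n] := ubnP #|A|; elim: n A => // n IHn A lt_An split_sub.
have [A_le1|A_gt1] := leqP #|A| 1.
  exists (fun=> A); split=> [r|]; first exact: monochromatic_small.
  rewrite prod_nat_const card_ord; case: #|A| A_le1 => [|[|//]] _.
    by rewrite powR0 ?gt_eqF.
  by rewrite powR1 exp1n.
have [A1 [A2 [x [y [A1A A2A [xA yA xy_gt0 maxd] sep le_pow]]]]] :=
  split_sub A (subxx A) A_gt1.
have IH (B : {set V}) : B \proper A -> exists S : 'I_p.+1 -> {set V},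
    (forall r, monochromatic B r (S r)) /\
    powR #|B|%:R s <= (\prod_r #|S r|)%N%:R.
  move=> BA; apply: IHn; first exact: leq_trans (proper_card BA) _.
  move=> C CB; apply: split_sub; exact: subset_trans CB (proper_sub BA).
have [S1 [S1c le1]] := IH _ A1A; have [S2 [S2c le2]] := IH _ A2A.
pose r0 := c (d x y).
exists (fun r => if r == r0 then S1 r :|: S2 r
  else if (#|S1 r| <= #|S2 r|)%N then S2 r else S1 r); split=> [r|].
  case: eqVneq => [->|_].
    exact: (monochromatic_setU (proper_sub A1A) (proper_sub A2A)).
  by case: ifP => _; [apply: (monochromatic_sub (proper_sub A2A))
                    | apply: (monochromatic_sub (proper_sub A1A))].
apply: le_trans le_pow (le_trans (lerD le1 le2) _).
(* Factor [r0] is the sum of the two sizes, and every other factor is at least each of them. *)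
rewrite -natrD ler_nat (bigD1 r0) //= [X in (_ + X)%N](bigD1 r0) //=.
rewrite [leqRHS](bigD1 r0) //= eqxx.
have -> : #|S1 r0 :|: S2 r0| = (#|S1 r0| + #|S2 r0|)%N.
  apply/eqP; rewrite (leq_card_setU (S1 r0) (S2 r0)).2 -setI_eq0.
  apply/set0Pn=> -[a /setIP[aS1 aS2]].
  have := sep a a (subsetP (S1c r0).1 a aS1) (subsetP (S2c r0).1 a aS2).
  by have [_ d_eq0 _ _] := d_metric; rewrite (d_eq0 a a).2 // leNgt g_gt0.
rewrite mulnDl leq_add // leq_mul // leq_prod // => r /negPf ->; case: ifP => //.
by move/negbT; rewrite -ltnNge => /ltnW.
Qed.

End Hierarchy.

(** * Subspaces and the two-point case *)

Lemma submetric_metric (R : realType) (V : finType) (d : V -> V -> R)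
    (S : {set V}) : is_metric d -> is_metric (submetric d S).
Proof.
move=> [d_ge0 d_eq0 d_sym d_tri]; rewrite /submetric; split=> // x y.
by split=> [/d_eq0/val_inj //|->]; apply/d_eq0.
Qed.

(** At most one positive distance occurs, so the gap condition only compares it with 0. *)
Lemma submetric_set2_is_HST (R : realType) (V : finType) (d : V -> V -> R)
    (k : R) (a b : V) : is_metric d -> 1 < k ->
  is_HST k (submetric d [set a; b]).
Proof.
move=> d_metric k_gt1; have [d_ge0 d_eq0 d_sym _] := d_metric.
have k_gt0 : 0 < k by apply: lt_trans k_gt1.
have d_xx x : d x x = 0 by apply/d_eq0.
apply: (ultrametric_is_HST (submetric_metric _ d_metric)) => //.
- move=> [x xS] [y yS] [z zS]; rewrite /submetric /= le_max.
  by move/set2P: xS => [] ->; move/set2P: yS => [] ->; move/set2P: zS => [] ->;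
    rewrite ?d_xx ?d_ge0 ?lexx ?orbT // (d_sym b a) lexx ?orbT.
- by exists a; rewrite !inE eqxx.
move=> [x xS] [y yS] [z zS] [w wS]; rewrite /submetric /=.
move/set2P: xS => [] ->; move/set2P: yS => [] -> //;
  rewrite ?d_xx ?divr_ge0 ?(ltW k_gt0) //;
  by move/set2P: zS => [] ->; move/set2P: wS => [] ->;
    rewrite ?(d_sym b a) ?d_xx ?ltxx // ltNge ?d_ge0.
Qed.

(** * Rounded diameters and their colours *)

(* Diameters are rounded down to powers of [l], and a level is coloured by its
   exponent modulo [p.+1]: two levels of one colour differ by a factor of at
   least [l ^ p.+1 >= k]. *)
Section Levels.

Variables (R : realType) (k l w : R) (p : nat).
Hypotheses (l_gt1 : 1 < l) (k_gt1 : 1 < k) (w_gt0 : 0 < w).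
Hypothesis k_le : ln k <= p.+1%:R * ln l.

Definition level (D : R) : int := Num.floor (ln D / ln l).

(** This is [l] to the power [level D], divided by [w]. With [w] equal to [3 * t] it is at most the
    width of a shell. *)
Definition level_value (D : R) : R := expR ((level D)%:~R * ln l) / w.

Definition level_colour (D : R) : 'I_p.+1 := inord `|(level D %% p.+1)%Z|%N.

Let ln_l_gt0 : 0 < ln l. Proof. exact: ln_gt0. Qed.

Lemma level_value_gt0 D : 0 < level_value D.
Proof. by rewrite divr_gt0 ?expR_gt0. Qed.

Lemma level_value_mono D E : 0 < D -> D <= E -> level_value D <= level_value E.
Proof.
move=> D_gt0 DE; rewrite ler_pM2r ?invr_gt0 // ler_expR ler_pM2r // ler_int.
apply: le_floor; rewrite ler_pM2r ?invr_gt0 // ler_ln ?posrE //.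
exact: lt_le_trans DE.
Qed.

Lemma level_value_le D : 0 < D -> level_value D <= D / w.
Proof.
move=> D_gt0; rewrite ler_pM2r ?invr_gt0 // -[leRHS]lnK ?posrE // ler_expR.
by rewrite -ler_pdivlMr // floor_le.
Qed.

Lemma level_value_ge D : 0 < D -> D <= w * l * level_value D.
Proof.
move=> D_gt0; rewrite /level_value; set e := expR _.
have -> : w * l * (e / w) = l * e by field; rewrite gt_eqF.
rewrite {}/e.
rewrite -[X in X * _]lnK ?posrE; last exact: lt_trans l_gt1.
rewrite -[leLHS]lnK ?posrE // -expRD ler_expR -[X in X + _]mul1r -mulrDl.
rewrite -ler_pdivrMr //; have /andP[_ /ltW] := floor_itv (ln D / ln l).
by rewrite intrD addrC.
Qed.

Lemma level_value_gap D E : level_colour D = level_colour E ->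
  level_value D < level_value E -> level_value D <= level_value E / k.
Proof.
have k_gt0 : 0 < k by apply: lt_trans k_gt1.
move=> /(congr1 (@nat_of_ord _)); rewrite /level_colour !inordK; last 2 first.
- by rewrite -ltz_nat gez0_abs ?modz_ge0 // ltz_pmod.
- by rewrite -ltz_nat gez0_abs ?modz_ge0 // ltz_pmod.
move=> /(congr1 Posz); rewrite !gez0_abs ?modz_ge0 // => /eqP.
rewrite eq_sym eqz_mod_dvd => /dvdzP[z Ez].
rewrite ltr_pM2r ?invr_gt0 // ltr_expR ltr_pM2r // ltr_int => lt_DE.
have z_gt0 : 0 < z.
  by rewrite -(pmulr_lgt0 z (isT : 0 < p.+1%:Z)) -Ez subr_gt0.
have le_lv : level D + p.+1%:Z <= level E.
  by rewrite addrC -lerBrDr Ez ler_peMl.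
rewrite mulrAC ler_pM2r ?invr_gt0 // ler_pdivlMr // -[X in _ * X]lnK ?posrE //.
rewrite -expRD ler_expR; apply: le_trans (lerD (lexx _) k_le) _.
by rewrite -mulrDl ler_pM2r // -[p.+1%:R]/(p.+1%:~R) -intrD ler_int.
Qed.

End Levels.

(** * Choosing the best colour *)

(** In the approximation factor, [3 * t] is the ratio of diameter to shell width and [l] the loss
    from rounding. *)
Lemma HST_subset (R : realType) (V : finType) (d : V -> V -> R)
    (beta k l : R) (t p : nat) :
  (0 < #|V|)%N -> is_metric d -> 1 < beta -> 1 < k -> 1 < l -> (0 < t)%N ->
  ln #|V|%:R < beta ^+ t * ln 2 -> ln k <= p.+1%:R * ln l ->
  exists2 S : {set V}, powR #|V|%:R (1 / (beta * p.+1%:R)) <= #|S|%:R &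
  exists2 d' : {x : V | x \in S} -> {x : V | x \in S} -> R,
    is_HST k d' & approximates (3 * t%:R * l) (submetric d S) d'.
Proof.
move=> V_gt0 d_metric beta_gt1 k_gt1 l_gt1 t_gt0 lt_ln k_le.
have beta_gt0 : 0 < beta by apply: lt_trans beta_gt1.
have [d_ge0 d_eq0 d_sym _] := d_metric.
have w_gt0 : 0 < 3 * t%:R :> R by rewrite mulr_gt0 // ltr0n.
have s_gt0 : 0 < beta^-1 by rewrite invr_gt0.
pose g := level_value l (3 * t%:R).
have g_gt0 D : 0 < g D by apply: level_value_gt0.
have [|S [S_mono le_prod]] := monochromatic_exists d_metric
  (level_colour l p) (fun D _ => g_gt0 D)
  (fun D E => level_value_mono l_gt1 w_gt0 (D := D) (E := E))
  (fun D => level_value_ge l_gt1 w_gt0 (D := D)) (A := setT) s_gt0.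
  move=> B _ B_gt1.
  have [|A1 [A2 [x [y [A1B A2B [xB yB xy_gt0 maxd] sep le_pow]]]]] :=
    metric_split d_metric beta_gt1 t_gt0 B_gt1.
    apply: le_lt_trans lt_ln; rewrite ler_ln ?posrE ?ltr0n ?ler_nat ?max_card //.
    exact: ltnW.
  exists A1, A2, x, y; split=> // a b aA1 bA2.
  exact: le_trans (level_value_le l_gt1 w_gt0 xy_gt0) (ltW (sep a b aA1 bA2)).
(* The size of the largest of the [p.+1] sets is at least the root of order [p.+1] of the
   product. *)
have [r _ maxr] := @arg_maxnP _ ord0 xpredT (fun r => #|S r|) isT.
have le_card : powR #|V|%:R (1 / (beta * p.+1%:R)) <= #|S r|%:R :> R.
  rewrite div1r invfM powRrM.
  have -> : #|S r|%:R = powR (powR #|S r|%:R p.+1%:R) p.+1%:R^-1 :> R.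
    by rewrite -powRrM divff ?powRr1 // pnatr_eq0.
  apply: ge0_ler_powR; rewrite ?nnegrE ?powR_ge0 ?invr_ge0 // powR_mulrn //.
  rewrite -cardsT; apply: le_trans le_prod _; rewrite -natrX ler_nat.
  rewrite -[X in (_ <= _ ^ X)%N]card_ord -prod_nat_const leq_prod //.
exists (S r) => //.
have [S_sub [u [u_xx u_sym u_val u_ultra u_d]]] := S_mono r.
pose u' (x y : {x : V | x \in S r}) := u (val x) (val y).
have u'_val x y : x != y -> exists D,
    [/\ level_colour l p D = r & u' x y = g D].
  rewrite -(inj_eq val_inj) => /(u_val _ _ (valP x) (valP y)).
  by case=> a [b [_ _ _ cr uE]]; exists (d a b).
have u'_xx x : u' x x = 0 by apply: u_xx (valP x).
have u'_ge0 x y : 0 <= u' x y.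
  by have [->|/u'_val[D [_ ->]]] := eqVneq x y; rewrite ?u'_xx // ltW.
have u'_ultra : is_ultrametric u'.
  by move=> x y z; apply: u_ultra; apply: valP.
exists u'; last by move=> x y; apply: u_d; apply: valP.
have [x0 x0S] : exists x, x \in S r.
  apply/card_gt0P; rewrite -(ltr0n R); apply: lt_le_trans le_card.
  by rewrite powR_gt0 ?ltr0n.
apply: (ultrametric_is_HST _ _ (exist _ x0 x0S)) => //.
- split=> // [x y|x y|x y z].
  + split=> [|->//]; apply: contra_eq => /u'_val[D [_ ->]].
    by rewrite gt_eqF.
  + by apply: u_sym; apply: valP.
  + apply: le_trans (u'_ultra x y z) _.
    by rewrite ge_max lerDl lerDr !u'_ge0.
move=> x y z v lt_u; have [->|/u'_val[D [cD uD]]] := eqVneq x y.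
  by rewrite u'_xx divr_ge0 // ltW // (lt_trans _ k_gt1).
have [ezv|/u'_val[E [cE uE]]] := eqVneq z v.
  by move: lt_u; rewrite ezv u'_xx ltNge u'_ge0.
rewrite uD uE in lt_u *.
exact: (level_value_gap l_gt1 k_gt1 w_gt0 k_le (etrans cD (esym cE)) lt_u).
Qed.

(** * The absolute constant *)

(** From exp(-1/6) >= 5/6 follows e <= (6/5)^6 < 3. This makes ln (ln 3) positive. *)
Lemma expR1_lt3 (R : realType) : expR 1 < 3 :> R.
Proof.
have step : expR 6^-1 <= 6 / 5 :> R.
  have := expR_ge1Dx (- 6^-1 : R); rewrite expRN.
  have := expR_gt0 (6^-1 : R); move: (expR 6^-1) => e e_gt0.
  rewrite -[e^-1]mul1r ler_pdivlMr // => le1; lra.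
have -> : expR 1 = expR 6^-1 ^+ 6 :> R by rewrite -expRM_natl; congr expR; field.
apply: le_lt_trans (_ : (6 / 5) ^+ 6 < 3); last lra.
by rewrite lerXn2r // nnegrE ?expR_ge0 //; lra.
Qed.
(* An approximation factor below 1 is impossible for two distinct points,
   while log_beta log n can be less than 1 or negative: O(x) is read as
   max(1, C x).  The unsubscripted logarithm is the natural one. *)
Theorem theorem3p6 (R : realType) :
  exists2 C : R, 0 < C &
  forall (V : finType) (d : V -> V -> R), (0 < #|V|)%N -> is_metric d ->
  forall beta k l : R, 1 < beta -> 1 < k -> 1 < l -> l <= k ->
  exists2 S : {set V},
    powR #|V|%:R (1 / (beta * (Num.ceil (logb l k))%:~R)) <= #|S|%:R &
    exists2 d' : {x : V | x \in S} -> {x : V | x \in S} -> R,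
      is_HST k d' &
      approximates (Num.max 1 (C * (l * logb beta (ln #|V|%:R))))
        (submetric d S) d'.
Proof.
have ln2_gt0 : 0 < ln 2 :> R by rewrite ln_gt0 ?ltr1n.
have ln2_lt1 : ln 2 < 1 :> R.
  rewrite -ltr_expR lnK ?posrE //.
  by apply: le_lt_trans (expR_gt1Dx (oner_neq0 _)).
have ln3_gt1 : 1 < ln 3 :> R by rewrite -ltr_expR lnK ?posrE // expR1_lt3.
have lnln2 : ln (ln 2) < 0 :> R by rewrite ln_lt0 // ln2_gt0.
have lnln3 : 0 < ln (ln 3) :> R by rewrite ln_gt0.
(* [K] absorbs the passage from log_2 n to ln n: ln (ln n / ln 2) <= K ln (ln n) for n >= 3, with
   equality at 3. *)
pose K : R := 1 - ln (ln 2) / ln (ln 3).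
have K_gt0 : 0 < K.
  by rewrite subr_gt0 (lt_trans _ ltr01) // pmulr_llt0 ?invr_gt0.
(* A factor 3 comes from the shell width and a factor 2 from rounding [t] to an integer. *)
exists (6 * K); first by rewrite mulr_gt0.
move=> V d V_gt0 d_metric beta k l beta_gt1 k_gt1 l_gt1 le_lk.
have [d_ge0 _ _ _] := d_metric.
have beta_gt0 : 0 < beta by apply: lt_trans beta_gt1.
have l_gt0 : 0 < l by apply: lt_trans l_gt1.
have k_gt0 : 0 < k by apply: lt_trans k_gt1.
have ln_l : 0 < ln l by rewrite ln_gt0.
have ln_beta : 0 < ln beta by rewrite ln_gt0.
have [p ceil_p] : exists p : nat, Num.ceil (logb l k) = p.+1%:Z.
  have : 0 < Num.ceil (logb l k).
    rewrite -(ltr_int R) (lt_le_trans _ (ceil_ge _)) //.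
    by rewrite divr_gt0 // ln_gt0.
  by case: (Num.ceil _) => [[|p]|] // _; exists p.
rewrite ceil_p -[p.+1%:~R]/(p.+1%:R).
have k_le : ln k <= p.+1%:R * ln l.
  by rewrite -ler_pdivrMr // -[p.+1%:R]/(p.+1%:~R) -ceil_p ceil_ge.
have n_gt0 : 0 < #|V|%:R :> R by rewrite ltr0n.
have [small|large] := leP (ln #|V|%:R) (beta * ln 2).
  (* Here n <= 2^beta, so the required size is at most 2, and [d] itself is an HST metric on two
     points or on a single one. *)
  have [a [b card_ab]] : exists a b : V,
      powR #|V|%:R (1 / (beta * p.+1%:R)) <= #|[set a; b]|%:R :> R.
    have [V_gt1|] := ltnP 1 #|V|.
      have [a [b [_ _ ab]]] := card_gt1P V_gt1; exists a, b.
      rewrite cards2 ab -ler_ln ?posrE ?powR_gt0 // ln_powR mulrC div1r.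
      rewrite ler_pdivrMr ?mulr_gt0 ?ltr0n //; apply: le_trans small _.
      rewrite mulrC ler_pM2l // ler_peMr ?ler1n //; exact: ltW.
    have [a _] := card_gt0P V_gt0 => V_le1; exists a, a.
    have -> : #|V| = 1%N by apply/eqP; rewrite eqn_leq V_le1.
    by rewrite powR1 setUid cards1.
  exists [set a; b] => //; exists (submetric d [set a; b]).
    exact: submetric_set2_is_HST.
  move=> x y; split=> //; apply: ler_peMl; first exact: d_ge0.
  by rewrite le_max lexx.
have n_ge3 : (3 <= #|V|)%N.
  rewrite ltnNge -(ler_nat R) -ler_ln ?posrE // -ltNge.
  by apply: le_lt_trans large; rewrite ler_peMl // ltW.
have ln_n_gt0 : 0 < ln #|V|%:R :> R.
  by apply: lt_trans large; rewrite mulr_gt0.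
have lnln_n : ln (ln 3) <= ln (ln #|V|%:R) :> R.
  by rewrite ler_ln ?posrE ?ler_ln ?posrE ?ler_nat // (lt_trans _ ln3_gt1).
(* [a] is log_beta log_2 n; it exceeds 1 because n > 2^beta. *)
pose a := ln (ln #|V|%:R / ln 2) / ln beta.
have a_gt1 : 1 < a.
  by rewrite ltr_pdivlMr // mul1r ltr_ln ?posrE ?divr_gt0 // ltr_pdivlMr.
have a_le : a <= K * logb beta (ln #|V|%:R).
  rewrite /logb mulrA ler_pM2r ?invr_gt0 // ln_div ?posrE // mulrBl mul1r.
  by rewrite lerD2l lerN2 mulrAC ler_pdivrMr // ler_nM2l.
(* Strictly above [a], so beta^t exceeds log_2 n, yet at most a + 1 <= 2a. *)
pose t := (Num.truncn a).+1.
have /andP[trunc_le lt_at] := truncn_itv (ltW (lt_trans ltr01 a_gt1)).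
have lt_ln : ln #|V|%:R < beta ^+ t * ln 2.
  rewrite -ltr_pdivrMr // -ltr_ln ?posrE ?divr_gt0 ?exprn_gt0 //.
  by rewrite lnXn // -[ln beta *+ t]mulr_natl -ltr_pdivrMr.
have [S S_card [d' d'_HST d'_approx]] :=
  HST_subset V_gt0 d_metric beta_gt1 k_gt1 l_gt1 (ltn0Sn _ : (0 < t)%N) lt_ln
    k_le.
exists S => //; exists d' => // x y; have [le_d d_le] := d'_approx x y.
split=> //; apply: le_trans d_le _; apply: ler_wpM2r.
  by have [[]] := d'_HST.
rewrite le_max; apply/orP; right.
have le_t : t%:R <= 2 * (K * logb beta (ln #|V|%:R)).
  apply: (@le_trans _ _ (a + 1)); first by rewrite /t -natr1 lerD2r.
  by rewrite mulr_natl mulr2n lerD // (le_trans (ltW a_gt1)).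
have -> : 6 * K * (l * logb beta (ln #|V|%:R)) =
  3 * (2 * (K * logb beta (ln #|V|%:R))) * l by ring.
by rewrite ler_pM2r // ler_pM2l.
Qed.
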